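(* Let $E,F$ be real vector spaces, $\tau>0$, and let $a:[0,\tau]\times E\times F\to\mathbb{R}$ and $b:[0,\tau]\times E\to\mathbb{R}$ be functions such that $\psi\mapsto a(t,\varphi,\psi)$ is linear for all $t\in[0,\tau]$ and $\varphi\in E$. Define $G:[0,\tau]\times E\times F\to\mathbb{R}$ by $G(t,\varphi,\psi):=a(t,\varphi,\psi)+b(t,\varphi)$. Assume that for each $t\in[0,\tau]$ there is a unique $u^t\in E$ such that $$a(t,u^t,\hat\psi)=0\quad\text{for all }\hat\psi\in F.$$ Assume further: (H0) For every $(t,\psi)\in[0,\tau]\times F$: (i) the function $[0,1]\ni s\mapsto G(t,su^t+(1-s)u^0,\psi)$ is absolutely continuous; (ii) for all $\hat\varphi\in E$ the function $[0,1]\ni s\mapsto d_\varphi G(t,su^t+(1-s)u^0,\psi;\hat\varphi)$ is well defined and belongs to $L^1(0,1)$. Assume that for each $t\in[0,\tau]$ there exists a unique solution $p^t\in F$ of the averaged adjoint equation $$\int_0^1 d_\varphi G(t,su^t+(1-s)u^0,p^t;\hat\varphi)\,ds=0\quad\text{for all }\hat\varphi\in E.$$ (H1) Assume that $$\lim_{t\searrow0}\frac{G(t,u^0,p^t)-G(0,u^0,p^t)}{t}=\partial_tG(0,u^0,p^0)$$ (in particular both sides exist). Then for every $\psi\in F$ the following derivatives exist and $$\frac{d}{dt}b(t,u^t)\Big|_{t=0}=\frac{d}{dt}\big(G(t,u^t,\psi)\big)\Big|_{t=0}=\partial_tG(0,u^0,p^0).$$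
   Context: $d_\varphi G(t,\varphi,\psi;\hat\varphi):=\lim_{h\to0}\frac{G(t,\varphi+h\hat\varphi,\psi)-G(t,\varphi,\psi)}{h}$ denotes the directional derivative of $G$ with respect to its second argument at $\varphi$ in direction $\hat\varphi$. All derivatives with respect to $t$ at $t=0$ are one-sided (limits of difference quotients as $t\searrow0$); in particular $\partial_tG(0,\varphi,\psi)=\lim_{t\searrow 0}\frac{G(t,\varphi,\psi)-G(0,\varphi,\psi)}{t}$. *)

(* Defs.v *)
From HB Require Import structures.
From mathcomp Require Import all_boot all_order all_algebra.
From mathcomp Require Import all_classical all_reals all_analysis.

Set Implicit Arguments.
Unset Strict Implicit.
Unset Printing Implicit Defensive.

Import Order.TTheory GRing.Theory Num.Theory.
Import numFieldNormedType.Exports.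

Local Open Scope classical_set_scope.
Local Open Scope ring_scope.

(* The base point and direction live in a bare vector space (no topology), so
   the library's ['D_v f x] does not apply; only the limit in [h] is taken. *)
Definition dir_quotient (R : realType) (E : lmodType R) (f : E -> R) (x v : E)
    (h : R) : R :=
  (f (x + h *: v) - f x) / h.

Definition dir_derivable (R : realType) (E : lmodType R) (f : E -> R)
    (x v : E) : Prop :=
  cvg (dir_quotient f x v h @[h --> (0 : R)^']).

Definition dir_derive (R : realType) (E : lmodType R) (f : E -> R)
    (x v : E) : R :=
  lim (dir_quotient f x v h @[h --> (0 : R)^']).

Definition rderivable0 (R : realType) (f : R -> R) : Prop :=
  cvg ((f t - f 0) / t @[t --> (0 : R)^'+]).

Definition rderive0 (R : realType) (f : R -> R) : R :=
  lim ((f t - f 0) / t @[t --> (0 : R)^'+]).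

Definition absolutely_continuous (R : realType) (a b : R) (f : R -> R) : Prop :=
  forall e : R, 0 < e -> exists2 d : R, 0 < d &
    forall (n : nat) (x y : 'I_n -> R),
      (forall i, [/\ a <= x i, x i <= y i & y i <= b]) ->
      trivIset setT (fun i => `]x i, y i[%classic) ->
      \sum_i (y i - x i) < d ->
      \sum_i `|f (y i) - f (x i)| < e.

(* [lebesgue_measure] is restricted to the Borel sets; the completed measure is
   used so that L^1 consists of all Lebesgue-measurable integrable functions. *)
Definition in_L1_01 (R : realType) (f : R -> R) : Prop :=
  (@completed_lebesgue_measure R).-integrable `]0, 1[%classic (EFin \o f).

Definition integral_01 (R : realType) (f : R -> R) : R :=
  \int[@completed_lebesgue_measure R]_(s in `]0, 1[%classic) f s.

Definition lagrangian (R : realType) (E F : lmodType R) (a : R -> E -> F -> R)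
    (b : R -> E -> R) (t : R) (phi : E) (psi : F) : R :=
  a t phi psi + b t phi.

Definition segment (R : realType) (E : lmodType R) (x y : E) (s : R) : E :=
  s *: y + (1 - s) *: x.

Definition state_eq (R : realType) (E F : lmodType R) (a : R -> E -> F -> R)
    (t : R) (v : E) : Prop :=
  forall psi : F, a t v psi = 0.

Definition averaged_adjoint_eq (R : realType) (E F : lmodType R)
    (G : R -> E -> F -> R) (u : R -> E) (t : R) (q : F) : Prop :=
  forall phi : E,
    integral_01
      (fun s => dir_derive (fun v => G t v q) (segment (u 0) (u t) s) phi) = 0.

(* Main.v *)
(* Since u^t solves the state equation, G(t, u^t, q) = b(t, u^t) for every q.
   The function s |-> G(t, s u^t + (1 - s) u^0, p^t) is differentiable at every
   point of [0, 1], with derivative d_phi G in the direction u^t - u^0, and this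
   derivative is integrable; the fundamental theorem of calculus and the averaged
   adjoint equation give G(t, u^t, p^t) = G(t, u^0, p^t). Hence
     b(t, u^t) - b(0, u^0) = G(t, u^0, p^t) - G(0, u^0, p^t),
   and (H1) concludes.

   The fundamental theorem needed is: if g is differentiable everywhere on [a, b]
   and g' is integrable, then the integral of g' is g(b) - g(a). Let h >= g' be
   integrable and bounded below, with indefinite integral F. By Lebesgue
   differentiation F' = h >= g' off a null set N; on N the difference F - g is
   corrected by a monotone function W of small total increase and infinite slope
   at the points of N. So F + W + e id - g is locally, hence globally,
   nondecreasing. Apply this to the truncations h = max(g', -n), and to -g. *)
Require Import Defs.
From HB Require Import structures.
From mathcomp Require Import all_boot all_order all_algebra.
From mathcomp Require Import all_classical all_reals all_analysis.
From mathcomp Require Import measurable_realfun lra.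

Set Implicit Arguments.
Unset Strict Implicit.
Unset Printing Implicit Defensive.

Import Order.TTheory GRing.Theory Num.Theory.
Import numFieldNormedType.Exports.

Local Open Scope classical_set_scope.
Local Open Scope ring_scope.

(** * Local comparison and functions steep on null sets *)

(** Let [S] be the set of points of the interval where [K] is at least [K a]. Comparison to the left
    of [sup S] puts [sup S] in [S]; comparison to its right would yield a larger element, unless
    [sup S = b]. *)
Lemma local_monotone_le (R : realType) (a b : R) (K : R -> R) : a <= b ->
  (forall x, a <= x <= b -> \forall y \near x, a <= y <= b ->
    (y <= x -> K y <= K x) /\ (x <= y -> K x <= K y)) ->
  K a <= K b.
Proof.
move=> ab Kloc.
pose S := [set x | a <= x <= b /\ K a <= K x].
have Sa : S a by rewrite /S /= lexx ab lexx.
have supS : has_sup S.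
  by split; [exists a|exists b => x [/andP[]]].
have ac : a <= sup S by apply: ub_le_sup => //; exact: supS.2.
have cb : sup S <= b by apply: ge_sup => [|x [/andP[]]]; first by exists a.
have /Kloc/nbhs_ballP[d /= d0 dK] : a <= sup S <= b by rewrite ac.
have Kac : K a <= K (sup S).
  have [x Sx xc] := sup_adherent d0 supS.
  have xsup : x <= sup S by apply: ub_le_sup => //; exact: supS.2.
  case: Sx => axb Kx; apply: (le_trans Kx).
  apply: (dK x _ axb).1 => //.
  by rewrite /ball /= ger0_norm ?subr_ge0// ltrBlDr addrC -ltrBlDr.
move: (cb); rewrite le_eqVlt => /orP[/eqP <-//|cltb].
pose y := Num.min b (sup S + d / 2).
have cy : sup S < y by rewrite /y lt_min cltb ltrDl divr_gt0.
have yab : a <= y <= b by rewrite ge_min lexx (le_trans ac (ltW cy)).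
have yd : y <= sup S + d / 2 by rewrite ge_min lexx orbT.
suff : S y by move/(ub_le_sup supS.2); rewrite leNgt cy.
split=> //; apply: (le_trans Kac).
apply: (dK y _ yab).2; last exact: ltW.
rewrite /ball /= distrC ger0_norm ?subr_ge0 ?(ltW cy)//.
by rewrite ltrBlDl (le_lt_trans yd)// ltrD2l ltr_pdivrMr// mulr_natr mulr2n ltrDl.
Qed.

(** [W] sums the functions sending [x] to the measure of [U k] to the left of [x], for open sets
    [U k] containing [N] of measure at most [e / 2 ^ k.+1]. The total stays below [e], while each
    [U k] adds slope 1 near [N]. *)
Lemma negligible_steep_function (R : realType) (N : set R) (e : R) :
  0 < e -> (@lebesgue_measure R).-negligible N ->
  exists W : R -> R, [/\ {homo W : x y / x <= y},
    forall x, 0 <= W x <= e &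
    forall x M, N x -> \forall y \near x,
      (y <= x -> M * (x - y) <= W x - W y) /\
      (x <= y -> M * (y - x) <= W y - W x)].
Proof.
move=> e0 /negligible_outer_measure N0.
pose mu := @lebesgue_measure R.
have [U HU] : {U : nat -> set R & forall k, [/\ open (U k), N `<=` U k
    & (mu (U k) <= (e / (2 ^ k.+1)%:R)%:E)%E]}.
  apply: (choice (P := fun k V => [/\ open V, N `<=` V
    & (mu V <= (e / (2 ^ k.+1)%:R)%:E)%E])) => k.
  have ek : 0 < e / (2 ^ k.+1)%:R by rewrite divr_gt0// ltr0n expn_gt0.
  have [V [oV NV muV]] := outer_measure_open_le N ek.
  by exists V; split => //; apply: (le_trans muV); rewrite N0 add0e.
have mU k : measurable (U k) by apply: open_measurable; case: (HU k).
have mUI k (i : interval R) : measurable (U k `&` [set` i]).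
  by apply: measurableI => //; exact: measurable_itv.
(* [S] has slope at least [n] around every point of [N], which lies in the
   interior of [U 0], ..., [U (n - 1)]. *)
pose S x := (\sum_(k <oo) mu (U k `&` `]-oo, x]))%E.
have S0 x : (0 <= S x)%E by apply: nneseries_ge0 => k _ _; exact: measure_ge0.
have Se x : (S x <= e%:E)%E.
  apply: le_trans (epsilon_trick0 xpredT (ltW e0)).
  apply: lee_nneseries => [k _ _|k _]; first exact: measure_ge0.
  have [_ _] := HU k; apply: le_trans.
  by apply: le_measure; rewrite ?inE; [exact: mUI|exact: mU|move=> t []].
have Sfin x : S x \is a fin_num.
  by rewrite ge0_fin_numE// (le_lt_trans (Se x))// ltry.
have SD y z : y <= z ->
    S z = (\sum_(k <oo) mu (U k `&` `]y, z]) + S y)%E.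
  move=> yz; rewrite /S -nneseriesD; [|by move=> k _ _; exact: measure_ge0..].
  apply: eq_eseriesr => k _; rewrite -measureU//.
  - congr (mu _); rewrite -setIUr setUC; congr (_ `&` _).
    by rewrite -itv_bndbnd_setU// bnd_simp.
  - exact: mUI.
  - exact: mUI.
  -
    apply/seteqP; split=> // t [[_ /=] + [_ /=]].
    by rewrite !in_itv/= => /andP[yt _] ty; move: (lt_le_trans yt ty); rewrite ltxx.
(* Only the first [n] terms of the series are kept; each contributes the full length [z - y]. *)
have SM n y z : y <= z -> (forall k, (k < n)%N -> `]y, z] `<=` U k) ->
    n%:R * (z - y) <= fine (S z) - fine (S y).
  move=> yz yzU.
  rewrite -lee_fin EFinB !fineK//.
  rewrite (SD _ _ yz) addeK//.
  apply: (@le_trans _ _ (\sum_(0 <= k < n) mu (U k `&` `]y, z]))%E); last first.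
    by apply: nneseries_lim_ge => k _ _; exact: measure_ge0.
  rewrite (eq_big_nat _ _ (F2 := fun=> (z - y)%:E)); last first.
    move=> k /andP[_ kn]; rewrite setIidr; last exact: yzU.
    rewrite /mu lebesgue_measure_itv/= lte_fin; case: ltP => // zy.
    by rewrite (@le_anti _ _ y z) ?yz// subrr.
  by rewrite sumEFin sumr_const_nat subn0 mulr_natl.
exists (fine \o S); split => [y z yz|x|x M Nx] /=.
(* Monotonicity is the case of slope 0, where no inclusion has to be checked. *)
- by rewrite -subr_ge0; have := SM 0 y z yz; rewrite mul0r; apply.
- by rewrite -!lee_fin fineK// S0 Se.
- have [n Mn] : exists n : nat, M <= n%:R.
    by exists (Num.bound `|M|); rewrite (le_trans (ler_norm _))// ltW// archi_boundP.
  have [d d0 dU] : exists2 d, 0 < d &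
      forall k, (k < n)%N -> `]x - d, x + d[ `<=` U k.
    clear Mn; elim: n => [|n [d d0 dU]]; first by exists 1.
    have [oU NU _] := HU n.
    have /nbhs_ballP[r /= r0 rU] : nbhs x (U n).
      by apply: open_nbhs_nbhs; split=> //; exact: NU.
    exists (Num.min d r); first by rewrite lt_min d0.
    move=> k; rewrite ltnS leq_eqVlt => /orP[/eqP ->|kn] t /=;
      rewrite in_itv /= => /andP[t1 t2].
      apply: rU; rewrite ball_itv /= in_itv/=.
      have mr : Num.min d r <= r by rewrite ge_min lexx orbT.
      by apply/andP; split; lra.
    apply: (dU _ kn); rewrite /= in_itv/=.
    have mr : Num.min d r <= d by rewrite ge_min lexx.
    by apply/andP; split; lra.
  apply/nbhs_ballP; exists d => //= y; rewrite ball_itv /= in_itv /= => /andP[y1 y2].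
  split=> xy.
  + apply: (@le_trans _ _ (n%:R * (x - y))); first by rewrite ler_wpM2r ?subr_ge0.
    apply: SM => // k /dU; apply: subset_trans => t /=; rewrite !in_itv/=.
    by move=> /andP[? ?]; apply/andP; split; lra.
  + apply: (@le_trans _ _ (n%:R * (y - x))); first by rewrite ler_wpM2r ?subr_ge0.
    apply: SM => // k /dU; apply: subset_trans => t /=; rewrite !in_itv/=.
    by move=> /andP[? ?]; apply/andP; split; lra.
Qed.

(** * One-sided comparison of increments with integrals *)

(** Clearing the denominator of the difference quotient includes the case [y = x] and leaves bounds
    suited to linear arithmetic. *)
Lemma derivable_near_affine (R : realType) (g : R -> R) (x e : R) :
  derivable g x 1 -> 0 < e ->
  \forall y \near x, `|g y - g x - g^`()%classic x * (y - x)| <= e * `|y - x|.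
Proof.
move=> dg e0.
have cg : h^-1 *: (g (h + x) - g x) @[h --> 0^'] --> g^`()%classic x.
  have -> : (fun h : R => h^-1 *: (g (h + x) - g x)) =
            (fun h : R => h^-1 *: (g (h *: 1 + x) - g x)).
    by apply/funext => h; rewrite [h *: 1]mulr1.
  rewrite derive1E; exact: dg.
move/cvgrPdist_le : cg => /(_ e e0); rewrite near_withinE => cg.
apply/nbhs0P; near=> h; rewrite [x + h]addrC addrK.
have [->|h0] := eqVneq h 0; first by rewrite add0r subrr mulr0 subr0 !normr0 mulr0.
have /(_ h0) : h != 0 -> `|g^`()%classic x - h^-1 *: (g (h + x) - g x)| <= e.
  by near: h.
rewrite -(ler_pM2r (x := `|h|)) ?normr_gt0// -normrM mulrBl /GRing.scale /=.
by rewrite mulrAC mulVf// mul1r distrC.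
Unshelve. all: by end_near. Qed.

(** This bounds the slopes of an indefinite integral from below even at points where it has no
    derivative. *)
Lemma le_increment_integral (R : realType) (h : R -> R) (m y z : R) :
  (@lebesgue_measure R).-integrable setT (EFin \o h) ->
  (forall x, m <= h x) -> y <= z ->
  m * (z - y) <= \int[@lebesgue_measure R]_(t in `]-oo, z]) h t -
                 \int[@lebesgue_measure R]_(t in `]-oo, y]) h t.
Proof.
move=> ih mh yz.
have ihS (D : set R) : measurable (D : set (measurableTypeR R)) ->
    (@lebesgue_measure R).-integrable D (EFin \o h).
  by move=> mD; exact: integrableS ih.
rewrite Rintegral_itvB ?bnd_simp//; last by apply: ihS; exact: measurable_itv.
have muI : @lebesgue_measure R `]y, z] = (z - y)%:E.
  rewrite lebesgue_measure_itv/= lte_fin; case: ltP => // zy.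
  by rewrite (@le_anti _ _ y z) ?yz// subrr.
have -> : m * (z - y) = \int[@lebesgue_measure R]_(x in `]y, z]) m.
  by rewrite Rintegral_cst// [X in fine X]muI.
apply: le_Rintegral => //; [|by apply: ihS; exact: measurable_itv].
apply: measurable_bounded_integrable => //; last exact: bounded_cst.
by rewrite [X in (X < _)%E]muI ltry.
Qed.

(** The bound [m] makes the null set harmless: the slopes of the indefinite integral are bounded
    below there, so a function of large finite slope makes up the deficit. *)
Lemma derive_le_increment_le_Rintegral (R : realType) (g h : R -> R) (a b m : R) :
  a <= b -> (forall x, a <= x <= b -> derivable g x 1) ->
  (@lebesgue_measure R).-integrable `]a, b[ (EFin \o h) ->
  (forall x, a < x < b -> m <= h x) ->
  (forall x, a < x < b -> g^`()%classic x <= h x) ->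
  g b - g a <= \int[@lebesgue_measure R]_(x in `]a, b[) h x.
Proof.
move=> ab dg ih mh g'h.
pose mu := @lebesgue_measure R.
pose h0 := h \_ `]a, b[.
have ih0 : mu.-integrable setT (EFin \o h0).
  by move: ih; rewrite integrable_mkcond//= (restrict_EFin h).
(* [h0] vanishes outside the interval, so its lower bound must be at most both [m] and 0. *)
pose c := - `|m|.
have ch0 x : c <= h0 x.
  rewrite /h0 patchE; case: ifPn => [|_]; last by rewrite /c oppr_le0.
  rewrite inE/= in_itv/= => /mh; apply: le_trans.
  by rewrite /c lerNl ler_normr lexx orbT.
clearbody c; clear mh.
pose F x := \int[mu]_(t in `]-oo, x]) h0 t.
have Finc y z : y <= z -> c * (z - y) <= F z - F y.
  by move=> yz; exact: le_increment_integral.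
have Fab : F b - F a = \int[mu]_(x in `]a, b[) h x.
  rewrite /F Rintegral_itvB ?bnd_simp//; last first.
    by apply: integrableS ih0 => //; exact: measurable_itv.
  rewrite -Rintegral_itv_bndo_bndc; last first.
    by apply: integrableS ih0 => //; exact: measurable_itv.
  by apply: eq_Rintegral => x xab; rewrite /h0 patchE xab.
have [N [N0 FN]] : exists N, mu.-negligible N /\
    forall x, ~ N x -> derivable F x 1 /\ F^`()%classic x = h0 x.
  exists (~` [set x | derivable F x 1 /\ F^`()%classic x = h0 x]).
  split=> [|x /contrapT//].
  apply: (@FTC1Ny R h0).
    by move=> y; apply: integrableS ih0 => //; exact: measurable_itv.
  by apply: open_integrable_locally => //; exact: openT.
(* The endpoints join the exceptional set because [h] dominates the derivative only inside the
   interval. *)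
have Nab : mu.-negligible (N `|` [set a; b]).
  apply: negligibleU => //; apply: negligibleU; apply/negligibleP;
  by [exact: measurable_set1|exact: lebesgue_measure_set1].
rewrite -Fab; apply/ler_addgt0Pr => e e0.
(* [W] costs at most [e'] and the linear term costs [e' * (b - a)], in total [e]. *)
pose e' := e / (1 + (b - a)).
have ba0 : 0 < 1 + (b - a) by rewrite ltr_wpDr// subr_ge0.
have e'0 : 0 < e' by rewrite divr_gt0.
(* [K] is monotone near each point: [W] absorbs everything on the exceptional
   null set, the derivative of [F + e' id - g] is positive elsewhere. *)
have -> : e = e' + e' * (b - a) by rewrite -{1}[e'](mulr1) -mulrDr divfK// gt_eqF.
have [W [Wnd We WN]] := negligible_steep_function e'0 Nab.
pose K x := F x + W x + e' * x - g x.
suff : K a <= K b.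
  by have := We a; have := We b; rewrite /K => /andP[? ?] /andP[? ?]; lra.
apply: local_monotone_le => // x xab.
have {}dg := dg x xab.
have [Nx|Nx] := pselect ((N `|` [set a; b]) x).
- have := derivable_near_affine dg ltr01.
  (* The first summand of this slope offsets the possible decrease of [F]; the second bounds the
     difference quotients of [g] near [x], up to the tolerance 1. *)
  have := WN x (`|c| + (`|g^`()%classic x| + 1)) Nx.
  apply: filterS2 => y [Wyx Wxy]; rewrite mul1r => gxy _.
  have prods t : 0 <= t -> [/\ 0 <= (`|c| + c) * t, 0 <= e' * t,
      0 <= (`|g^`()%classic x| - g^`()%classic x) * t &
      0 <= (`|g^`()%classic x| + g^`()%classic x) * t].
    move=> t0; split; apply: mulr_ge0; rewrite ?(ltW e'0)// ?subr_ge0 ?ler_norm//;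
    by rewrite -lerBlDr sub0r -normrN ler_norm.
  split=> [yx|xy].
  + have yx0 : 0 <= x - y by rewrite subr_ge0.
    have [p1 p2 p3 p4] := prods _ yx0.
    move: gxy; rewrite [`|y - x|]distrC (ger0_norm yx0) ler_norml => /andP[gxy1 gxy2].
    have := Wyx yx; have := Finc _ _ yx; rewrite /K; lra.
  + have xy0 : 0 <= y - x by rewrite subr_ge0.
    have [p1 p2 p3 p4] := prods _ xy0.
    move: gxy; rewrite (ger0_norm xy0) ler_norml => /andP[gxy1 gxy2].
    have := Wxy xy; have := Finc _ _ xy; rewrite /K; lra.
- have [dF F'x] : derivable F x 1 /\ F^`()%classic x = h0 x.
    by apply: FN; apply: contra_not Nx; left.
  have axb : a < x < b.
    have xa : x != a by apply/eqP => xa; apply: Nx; right; left.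
    have xb : x != b by apply/eqP => xb; apply: Nx; right; right.
    by move: xab; rewrite !le_eqVlt eq_sym (negbTE xa) (negbTE xb).
  have hx : h0 x = h x by rewrite /h0 patchE mem_set//= in_itv.
  (* The affine approximations of [F] and [g] each get half of the slope [e'] of the linear term. *)
  have e'2 : 0 < e' / 2 by rewrite divr_gt0.
  have := derivable_near_affine dg e'2.
  have := derivable_near_affine dF e'2.
  rewrite F'x hx; have := g'h x axb.
  move=> g'hx; apply: filterS2 => y Fxy gxy _.
  have p t : 0 <= t -> 0 <= (h x - g^`()%classic x) * t.
    by move=> t0; rewrite mulr_ge0// subr_ge0.
  split=> [yx|xy].
  + have yx0 : 0 <= x - y by rewrite subr_ge0.
    have p0 := p _ yx0; have := Wnd _ _ yx.
    move: gxy Fxy; rewrite [`|y - x|]distrC (ger0_norm yx0) !ler_norml.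
    move=> /andP[gxy1 gxy2] /andP[Fxy1 Fxy2]; rewrite /K; lra.
  + have xy0 : 0 <= y - x by rewrite subr_ge0.
    have p0 := p _ xy0; have := Wnd _ _ xy.
    move: gxy Fxy; rewrite (ger0_norm xy0) !ler_norml.
    move=> /andP[gxy1 gxy2] /andP[Fxy1 Fxy2]; rewrite /K; lra.
Qed.

(** * Borel and completed Lebesgue measure; measurability of derivatives *)

Lemma measurable_fun_completed_id (R : realType) :
  measurable_fun [set: caratheodory_type (@wlength R idfun)^*%mu]
    (id : caratheodory_type (@wlength R idfun)^*%mu -> measurableTypeR R).
Proof. by move=> _ A mA; rewrite setTI preimage_id; exact: sub_caratheodory. Qed.

(** The two measures give equal integrals to nonnegative Borel functions. This is applied to the
    absolute value of [f] for integrability, and to its positive and negative parts for the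
    integral. *)
Lemma Rintegral_completed_lebesgue_measure (R : realType) (D : set R)
    (f : measurableTypeR R -> R) :
  measurable (D : set (measurableTypeR R)) ->
  measurable_fun (D : set (measurableTypeR R)) f ->
  (@completed_lebesgue_measure R).-integrable D (EFin \o f) ->
  (@lebesgue_measure R).-integrable D (EFin \o f) /\
  \int[@completed_lebesgue_measure R]_(x in D) f x =
   \int[@lebesgue_measure R]_(x in D) f x.
Proof.
move=> mD mf /integrableP[_ fi].
(* The identity pushes the completed measure forward to the Borel one. *)
have mid := @measurable_fun_completed_id R.
have E (g : measurableTypeR R -> \bar R) :
    measurable_fun (D : set (measurableTypeR R)) g -> (forall x, 0 <= g x)%E ->
    (\int[@lebesgue_measure R]_(x in D) g x =
     \int[@completed_lebesgue_measure R]_(x in D) g x)%E.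
  move=> mg g0.
  have := ge0_integral_pushforward mid (@completed_lebesgue_measure R) mD mg
    (fun y _ => g0 y).
  by rewrite /= => <-; apply: eq_measure_integral.
have mF : measurable_fun (D : set (measurableTypeR R)) (EFin \o f).
  exact/measurable_EFinP.
split.
  apply/integrableP; split=> //.
  by rewrite E//; apply: measurableT_comp => //.
rewrite /Rintegral [in LHS]integralE [in RHS]integralE !E//;
  [exact: measurable_funeneg|exact: measurable_funepos].
Qed.

(** The derivative is the pointwise limit of the difference quotients with steps [1 / (n + 1)],
    which are measurable since [g] is continuous on [D]. *)
Lemma measurable_fun_derive1 (R : realType) (g : R -> R) (D : set R) :
  open D -> (forall x, D x -> derivable g x 1) ->
  measurable_fun D g^`()%classic.
Proof.
move=> oD dg.
have mD : measurable D by exact: open_measurable.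
have mg : measurable_fun setT (g \_ D).
  apply: (measurable_restrictT g mD).1.
  apply: open_continuous_measurable_fun => // x; rewrite inE => Dx.
  exact/differentiable_continuous/derivable1_diffP/dg.
have mh (c : R) : measurable_fun setT (fun x => (g \_ D) (c + x)).
  by apply: (measurableT_comp mg); exact: measurable_funD.
(* [g] is cut off outside [D], where nothing is known about it; this does not
   change the difference quotients at a point of [D] for small increments. *)
pose q n x : R := n.+1%:R * ((g \_ D) (n.+1%:R^-1 + x) - (g \_ D) x).
apply: (@measurable_fun_cvg _ _ _ _ q) => [n|x Dx].
  apply: measurable_funTS.
  apply: (measurable_funM (measurable_cst _)); exact: measurable_funB.
have dgx : h^-1 *: (g (h + x) - g x) @[h --> 0^'] --> g^`()%classic x.
  have -> : (fun h : R => h^-1 *: (g (h + x) - g x)) =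
            (fun h : R => h^-1 *: (g (h *: 1 + x) - g x)).
    by apply/funext => h; rewrite [h *: 1]mulr1.
  by rewrite derive1E; exact: dg.
have [cn0 cn] : (forall n : nat, n.+1%:R^-1 != 0 :> R) /\
    n.+1%:R^-1 @[n --> \oo] --> (0 : R).
  by split=> [n|]; [rewrite invr_eq0 pnatr_eq0|exact: cvg_harmonic].
have := (cvgr_dnbhsP _ _ _).1 dgx (fun n => n.+1%:R^-1) (conj cn0 cn).
apply: cvg_trans; apply: near_eq_cvg; near=> n.
rewrite /q invrK !patchE !mem_set//.
near: n.
have : n.+1%:R^-1 + x @[n --> \oo] --> 0 + x by apply: cvgD => //; exact: cvg_cst.
by apply; rewrite add0r; exact: open_nbhs_nbhs.
Unshelve. all: by end_near. Qed.

(** * The fundamental theorem for integrable derivatives *)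

Lemma increment_le_Rintegral_derive (R : realType) (g : R -> R) (a b : R) :
  a <= b -> (forall x, a <= x <= b -> derivable g x 1) ->
  (@lebesgue_measure R).-integrable `]a, b[ (EFin \o g^`()%classic) ->
  g b - g a <= \int[@lebesgue_measure R]_(x in `]a, b[) g^`()%classic x.
Proof.
move=> ab dg ig.
pose mu := @lebesgue_measure R.
(* Truncating the derivative from below makes the one-sided comparison
   available; the truncation is removed by dominated convergence. *)
pose f n x : R := Num.max (g^`()%classic x) (- n%:R).
have mf n : measurable_fun `]a, b[ (EFin \o f n).
  rewrite (_ : EFin \o f n = fun x => maxe (g^`()%classic x)%:E (- n%:R)%:E).
    by apply: measurable_maxe => //; exact: measurable_int ig.
  by apply/funext => x; rewrite /f /= EFin_max.
(* The truncation level is nonpositive, so truncating never increases the absolute value. *)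
have fg n x : `|f n x| <= `|g^`()%classic x|.
  rewrite /f; case: (leP (g^`()%classic x) (- n%:R)) => // gn.
  have n0 : 0 <= n%:R :> R by [].
  by rewrite normrN ger0_norm// ler0_norm; lra.
have if_ n : mu.-integrable `]a, b[ (EFin \o f n).
  apply: le_integrable ig => //; first by move: (mf n).
  by move=> x _; rewrite lee_fin; exact: fg.
have : (\int[mu]_(x in `]a, b[) (f n x)%:E)%E @[n --> \oo] -->
    (\int[mu]_(x in `]a, b[) (g^`()%classic x)%:E)%E.
  apply: (@dominated_cvg _ _ R mu _ (measurable_itv _) _ _
    (fun x => `|g^`()%classic x|%:E)) => //.
  - move=> x _; apply: cvg_near_cst; near=> n; congr (_%:E).
    apply/max_idPl; rewrite lerNl.
    near: n; exact: nbhs_infty_ger.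
  - exact: integrable_norm.
  - by move=> n x _; rewrite lee_fin; exact: fg.
move=> cvf; rewrite -lee_fin /Rintegral fineK; last first.
  exact: integrable_fin_num.
rewrite -(cvg_lim _ cvf)//; apply: lime_ge; first exact: cvgP cvf.
apply: nearW => n.
have := derive_le_increment_le_Rintegral ab dg (if_ n) (m := - n%:R).
rewrite -lee_fin /Rintegral fineK; last first.
  exact: (integrable_fin_num _ (if_ n)).
by apply=> x _; rewrite /f le_max lexx// orbT.
Unshelve. all: by end_near. Qed.

(** The reverse inequality is the one-sided result for [- g]. *)
Lemma Rintegral_derive (R : realType) (g : R -> R) (a b : R) :
  a <= b -> (forall x, a <= x <= b -> derivable g x 1) ->
  (@lebesgue_measure R).-integrable `]a, b[ (EFin \o g^`()%classic) ->
  \int[@lebesgue_measure R]_(x in `]a, b[) g^`()%classic x = g b - g a.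
Proof.
move=> ab dg ig; apply/eqP; rewrite eq_le increment_le_Rintegral_derive// andbT.
have NE x : `]a, b[%classic x -> (- g)^`()%classic x = - g^`()%classic x.
  rewrite /= in_itv/= => /andP[ax xb]; apply: derive1N.
  by apply: dg; rewrite !ltW.
have iN : (@lebesgue_measure R).-integrable `]a, b[ (EFin \o (- g)^`()%classic).
  have := integrableN ig; apply: eq_integrable => //; try exact: measurable_itv.
  by move=> x; rewrite inE => /NE /= ->.
have := increment_le_Rintegral_derive ab _ iN.
have -> : \int[@lebesgue_measure R]_(x in `]a, b[) (- g)^`()%classic x =
    \int[@lebesgue_measure R]_(x in `]a, b[) (-1 * g^`()%classic x).
  by apply: eq_Rintegral => x; rewrite inE => /NE ->; rewrite mulN1r.
rewrite RintegralZl//.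
rewrite mulN1r /= -opprD lerN2; apply => x xab; exact/derivableN/dg.
Qed.

(** * Directional derivatives along segments *)

(** Moving the parameter by [h] moves the point by [h *: (y - x)], so the two difference quotients
    are the same function of [h]. As [segment] is affine on all of [R], they are two-sided even at
    parameters 0 and 1. *)
Lemma dir_derivable_derivable_segment (R : realType) (E : lmodType R)
    (f : E -> R) (x y : E) (s : R) :
  dir_derivable f (segment x y s) (y - x) ->
  derivable (f \o segment x y) s 1 /\
  (f \o segment x y)^`()%classic s = dir_derive f (segment x y s) (y - x).
Proof.
have Q : (fun h => h^-1 *: ((f \o segment x y) (h + s) - (f \o segment x y) s))
    = dir_quotient f (segment x y s) (y - x).
  apply/funext => h; rewrite /dir_quotient /= mulrC; congr (_ * (f _ - _)).
  rewrite /segment opprD addrCA [X in X *: x]addrC scalerDl scaleNr scalerBl.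
  by rewrite scalerDl scalerBr [h *: y + _]addrC scalerBl addrACA.
have Q1 : (fun h => h^-1 *: ((f \o segment x y) (h *: 1 + s) - (f \o segment x y) s))
    = dir_quotient f (segment x y s) (y - x).
  by rewrite -Q; apply/funext => h; rewrite [h *: 1]mulr1.
split.
  by rewrite /derivable Q1.
by rewrite /dir_derive -Q.
Qed.

Lemma increment_segment (R : realType) (E : lmodType R)
    (f : E -> R) (x y : E) :
  (forall s, s \in `[0, 1] -> dir_derivable f (segment x y s) (y - x)) ->
  in_L1_01 (fun s => dir_derive f (segment x y s) (y - x)) ->
  integral_01 (fun s => dir_derive f (segment x y s) (y - x)) = f y - f x.
Proof.
move=> df if1; pose g := f \o segment x y.
have dg s : 0 <= s <= 1 -> derivable g s 1 /\
    g^`()%classic s = dir_derive f (segment x y s) (y - x).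
  by move=> s01; apply/dir_derivable_derivable_segment/df; rewrite in_itv.
have g01 s : s \in `]0, 1[%classic ->
    dir_derive f (segment x y s) (y - x) = g^`()%classic s.
  rewrite inE /= in_itv/= => /andP[s0 s1]; have [|_ ->//] := dg s.
  by rewrite !ltW.
(* The derivative of [g] is Borel measurable, which allows the passage from the completed measure to
   the Borel one. *)
have [ig intg] : (@lebesgue_measure R).-integrable `]0, 1[ (EFin \o g^`()%classic) /\
    \int[@completed_lebesgue_measure R]_(x in `]0, 1[) g^`()%classic x =
    \int[@lebesgue_measure R]_(x in `]0, 1[) g^`()%classic x.
  apply: Rintegral_completed_lebesgue_measure => //.
    apply: measurable_fun_derive1; first exact: interval_open.
    by move=> s /=; rewrite in_itv/= => /andP[s0 s1]; apply: (dg s _).1; rewrite !ltW.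
  apply: eq_integrable if1 => //.
    by apply: sub_caratheodory; exact: measurable_itv.
  by move=> s /g01 /= ->.
rewrite /integral_01.
transitivity (\int[@completed_lebesgue_measure R]_(x in `]0, 1[) g^`()%classic x).
  exact: eq_Rintegral.
rewrite intg Rintegral_derive//.
  by rewrite /g /segment /= subrr subr0 !scale1r !scale0r addr0 add0r.
by move=> s /dg[].
Qed.

(** * The averaged adjoint argument *)

Theorem theorem2p1 (R : realType) (E F : lmodType R) (tau : R) (tau_gt0 : 0 < tau)
    (a : R -> E -> F -> R) (b : R -> E -> R)
    (a_linear : forall (t : R) (phi : E), t \in `[0, tau] -> scalar (a t phi))
    (u : R -> E)
    (u_state : forall t : R, t \in `[0, tau] -> unique (state_eq a t) (u t))
    (H0_i : forall (t : R) (psi : F), t \in `[0, tau] ->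
      absolutely_continuous 0 1
        (fun s => lagrangian a b t (segment (u 0) (u t) s) psi))
    (H0_ii : forall (t : R) (psi : F) (phi : E), t \in `[0, tau] ->
      (forall s : R, s \in `[0, 1] ->
        dir_derivable (fun v => lagrangian a b t v psi)
          (segment (u 0) (u t) s) phi) /\
      in_L1_01 (fun s => dir_derive (fun v => lagrangian a b t v psi)
                           (segment (u 0) (u t) s) phi))
    (p : R -> F)
    (p_adjoint : forall t : R, t \in `[0, tau] ->
      unique (averaged_adjoint_eq (lagrangian a b) u t) (p t))
    (H1_ex : rderivable0 (fun t => lagrangian a b t (u 0) (p 0)))
    (H1 : (lagrangian a b t (u 0) (p t) - lagrangian a b 0 (u 0) (p t)) / t
            @[t --> (0 : R)^'+]
          --> rderive0 (fun t => lagrangian a b t (u 0) (p 0))) :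
  forall psi : F,
    [/\ rderivable0 (fun t => b t (u t)),
        rderivable0 (fun t => lagrangian a b t (u t) psi),
        rderive0 (fun t => b t (u t))
          = rderive0 (fun t => lagrangian a b t (u t) psi)
      & rderive0 (fun t => lagrangian a b t (u t) psi)
          = rderive0 (fun t => lagrangian a b t (u 0) (p 0))].
Proof.
move=> psi; pose G := lagrangian a b.
have zin : (0 : R) \in `[0, tau] by rewrite in_itv/= lexx ltW.
have Gb t q : t \in `[0, tau] -> G t (u t) q = b t (u t).
  by move=> /u_state[ut _]; rewrite /G /lagrangian ut add0r.
have Gu t : t \in `[0, tau] -> G t (u t) (p t) = G t (u 0) (p t).
  move=> tin; have [pt _] := p_adjoint t tin.
  have [df if1] := H0_ii t (p t) (u t - u 0) tin.
  have := increment_segment df if1; rewrite pt => /eqP.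
  by rewrite eq_sym subr_eq0 => /eqP.
have tau_near : \forall t \near (0 : R)^'+, t \in `[0, tau].
  near=> t; rewrite in_itv/=; apply/andP; split; first by near: t; exact: nbhs_right_ge.
  by near: t; exact: nbhs_right_le.
have cb : (b t (u t) - b 0 (u 0)) / t @[t --> (0 : R)^'+]
    --> rderive0 (fun t => G t (u 0) (p 0)).
  apply: cvg_trans H1; apply: near_eq_cvg; near=> t.
  have tin : t \in `[0, tau] by near: t.
  (* The state equation is tested with [p t] at both times [t] and 0, which turns the quotient in
     [H1] into that of [b]. *)
  by rewrite -/G -Gu// !Gb.
have cG : (G t (u t) psi - G 0 (u 0) psi) / t @[t --> (0 : R)^'+]
    --> rderive0 (fun t => G t (u 0) (p 0)).
  apply: cvg_trans cb; apply: near_eq_cvg; near=> t.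
  have tin : t \in `[0, tau] by near: t.
  by rewrite !Gb.
have Eb : rderive0 (fun t => b t (u t)) = rderive0 (fun t => G t (u 0) (p 0)).
  exact: cvg_lim cb.
have EG : rderive0 (fun t => G t (u t) psi) = rderive0 (fun t => G t (u 0) (p 0)).
  exact: cvg_lim cG.
split => //; [exact: cvgP cb|exact: cvgP cG|by rewrite Eb EG].
Unshelve. all: by end_near. Qed.
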